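(* Let $\mathcal{I},\mathcal{J},\mathcal{K}$ be ideals on $\omega$. Then (1) $\mathfrak{b}(>_{\mathcal{I}}\cap(\mathcal{D}_{\mathcal{K}}\times\mathcal{D}_{\mathcal{J}}))=\mathfrak{b}(\mathcal{I},\mathcal{J},\mathcal{K})$; (2) $\mathfrak{b}(\geq_{\mathcal{I}}\cap(\mathcal{D}_{\mathcal{K}}\times\mathcal{D}_{\mathcal{J}}))=\mathfrak{b}_s(\mathcal{I},\mathcal{J},\mathcal{K})$.
   Context: An ideal on a set $X$ is a family $\mathcal{I}\subseteq\mathcal{P}(X)$ closed under finite unions and subsets, containing all finite subsets of $X$, with $X\notin\mathcal{I}$. For an ideal $\mathcal{I}$ on $\omega$ and $f,g\in\omega^\omega$: $f>_{\mathcal{I}}g$ iff $\{n: f(n)\le g(n)\}\in\mathcal{I}$, and $f\geq_{\mathcal{I}}g$ iff $\{n:f(n)<g(n)\}\in\mathcal{I}$. Let $\mathcal{D}_{\mathcal{I}}=\{f\in\omega^\omega: f^{-1}[\{n\}]\in\mathcal{I}\text{ for every }n\in\omega\}$. For a binary relation $R$, with $\mathrm{dom}(R)=\{x:\exists y\,(x,y)\in R\}$ and $\mathrm{ran}(R)=\{y:\exists x\,(x,y)\in R\}$, a set $B\subseteq\mathrm{dom}(R)$ is $R$-unbounded if for every $y\in\mathrm{ran}(R)$ there is $x\in B$ with $(x,y)\notin R$, and $\mathfrak{b}(R)=\min\{|B|: B\text{ is }R\text{-unbounded}\}$; here $>_{\mathcal{I}}\cap(\mathcal{D}_{\mathcal{K}}\times\mathcal{D}_{\mathcal{J}})$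 is the set of pairs $(f,g)\in\mathcal{D}_{\mathcal{K}}\times\mathcal{D}_{\mathcal{J}}$ with $f>_{\mathcal{I}}g$ (similarly for $\geq_{\mathcal{I}}$). Convention: $\min\emptyset=\mathfrak{c}^+$. For an ideal $\mathcal{I}$ on $\omega$, $\widehat{\mathcal{P}}_{\mathcal{I}}$ is the family of all sequences $\langle A_n:n\in\omega\rangle$ of pairwise disjoint members of $\mathcal{I}$, and $\mathcal{P}_{\mathcal{I}}$ is the set of those with $\bigcup_n A_n=\omega$. For ideals $\mathcal{I},\mathcal{J},\mathcal{K}$ on $\omega$, $\mathfrak{b}(\mathcal{I},\mathcal{J},\mathcal{K})=\min\{|\mathcal{E}|:\mathcal{E}\subseteq\widehat{\mathcal{P}}_{\mathcal{K}}\text{ and for every }\langle A_n\rangle\in\mathcal{P}_{\mathcal{J}}\text{ there is }\langle E_n\rangle\in\mathcal{E}\text{ with }\bigcup_{n}(A_n\cap\bigcup_{i\le n}E_i)\notin\mathcal{I}\}$, $\mathfrak{b}_s(\mathcal{I},\mathcal{J},\mathcal{K})$ is defined the same way but with $\bigcup_{n}(A_{n+1}\cap\bigcup_{i\le n}E_i)\notin\mathcal{I}$.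
   Formalization: Unbounded sets B range over subsets of D_K rather than of dom(R), with no g in D_J bounding B; with B ⊆ dom(R) taken literally both equalities fail, e.g. for I = J = Fin and K containing an infinite set, where the right sides are 1 but the left sides are not. *)

(* Defs.v *)
From mathcomp Require Import all_boot.
From mathcomp Require Import boolp classical_sets functions cardinality.

Set Implicit Arguments.
Unset Strict Implicit.
Unset Printing Implicit Defensive.

Local Open Scope classical_set_scope.
Local Open Scope card_scope.

(* Cardinal numbers in the sense of Frege and Russell: a cardinal is the class
   of all types of that cardinality.  Equality of cardinals is then Leibniz
   equality. *)
Definition cardinal := Type -> Prop.

Definition card_lt (T U : Type) (A : set T) (B : set U) : Prop :=
  (A #<= B) /\ ~ (B #<= A).

Definition cardinal_of (X : Type) (B : set X) : cardinal :=
  fun T => [set: T] #= B.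

Definition continuum_succ : cardinal := fun T =>
  card_lt [set: set nat] [set: T] /\
  forall U : Type, card_lt [set: set nat] [set: U] -> [set: T] #<= [set: U].

(* The minimum of the cardinalities of the members of F, with the convention
   that the minimum of the empty family is the successor of the continuum. *)
Definition min_card (X : Type) (F : set (set X)) : cardinal := fun T =>
  (exists B, [/\ F B, (forall C, F C -> B #<= C) & cardinal_of B T]) \/
  (F = set0 /\ continuum_succ T).

Record is_ideal (X : Type) (I : set (set X)) : Prop := IsIdeal {
  idealU : forall A B, I A -> I B -> I (A `|` B) ;
  ideal_sub : forall A B, A `<=` B -> I B -> I A ;
  ideal_finite : forall A, finite_set A -> I A ;
  ideal_proper : ~ I [set: X]
}.

Definition gt_ideal (I : set (set nat)) : set ((nat -> nat) * (nat -> nat)) :=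
  [set fg | I [set n | (fg.1 n <= fg.2 n)%N]].

Definition ge_ideal (I : set (set nat)) : set ((nat -> nat) * (nat -> nat)) :=
  [set fg | I [set n | (fg.1 n < fg.2 n)%N]].

Definition D_ideal (I : set (set nat)) : set (nat -> nat) :=
  [set f | forall n, I (f @^-1` [set n])].

Definition dom (X Y : Type) (R : set (X * Y)) : set X :=
  [set x | exists y, R (x, y)].

Definition ran (X Y : Type) (R : set (X * Y)) : set Y :=
  [set y | exists x, R (x, y)].

(* Here R is regarded as a relation between D (the challenges) and C (the
   responses): an R-unbounded set is a subset of D that no element of C
   R-dominates. *)
Definition unbounded (X Y : Type) (D : set X) (C : set Y) (R : set (X * Y))
    (B : set X) : Prop :=
  B `<=` D /\ forall y, C y -> exists2 x, B x & ~ R (x, y).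

(* With D := dom R and C := ran R this is the bounding number of the bare set of
   pairs R.  For R := gt_ideal I `&` (D_ideal K `*` D_ideal J), and likewise for
   ge_ideal, the intended domain is D_ideal K, all of it: ran R = D_ideal J
   always holds (lemmas ran_gt, ran_ge), but dom R may be smaller than D_ideal K,
   and a bounding number computed with B `<=` dom R is never 1, whereas
   b_ideal I J K and bs_ideal I J K may be 1 (lemmas gt_dom_counterexample,
   ge_dom_counterexample).  When D_ideal K `<=` dom R the two agree
   (lemmas bounding_gt_dom, bounding_ge_dom). *)
Definition bounding (X Y : Type) (D : set X) (C : set Y) (R : set (X * Y)) :
  cardinal := min_card [set B | unbounded D C R B].

Definition P_hat (I : set (set nat)) : set (nat -> set nat) :=
  [set A | (forall n, I (A n)) /\ trivIset [set: nat] A].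

Definition P_part (I : set (set nat)) : set (nat -> set nat) :=
  [set A | P_hat I A /\ \bigcup_n A n = [set: nat]].

Definition b_ideal (I J K : set (set nat)) : cardinal :=
  min_card [set E : set (nat -> set nat) | E `<=` P_hat K /\
    forall A, P_part J A -> exists2 e, E e &
      ~ I (\bigcup_n (A n `&` \bigcup_(i in [set i | (i <= n)%N]) e i))].

Definition bs_ideal (I J K : set (set nat)) : cardinal :=
  min_card [set E : set (nat -> set nat) | E `<=` P_hat K /\
    forall A, P_part J A -> exists2 e, E e &
      ~ I (\bigcup_n (A n.+1 `&` \bigcup_(i in [set i | (i <= n)%N]) e i))].

Section DomainOfTheRelation.

Lemma D_ideal_maxid (K : set (set nat)) (g : nat -> nat) :
  is_ideal K -> D_ideal K (fun n => (maxn (g n) n).+1).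
Proof.
move=> iK n; apply: (ideal_finite iK); apply: (sub_finite_set _ (finite_II n)).
by move=> m /= <-; rewrite ltnS leq_maxr.
Qed.

Lemma ran_gt (I J K : set (set nat)) : is_ideal I -> is_ideal K ->
  ran (gt_ideal I `&` (D_ideal K `*` D_ideal J)) = D_ideal J.
Proof.
move=> iI iK; apply/seteqP; split=> [g [f [_ []]]//|g Dg].
exists (fun n => (maxn (g n) n).+1); split; last first.
  by split=> //; exact: D_ideal_maxid.
apply: (ideal_finite iI); apply: (sub_finite_set _ (finite_set0 _)) => n /=.
by rewrite ltnNge leq_maxl.
Qed.

Lemma ran_ge (I J K : set (set nat)) : is_ideal I -> is_ideal K ->
  ran (ge_ideal I `&` (D_ideal K `*` D_ideal J)) = D_ideal J.
Proof.
move=> iI iK; apply/seteqP; split=> [g [f [_ []]]//|g Dg].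
exists (fun n => (maxn (g n) n).+1); split; last first.
  by split=> //; exact: D_ideal_maxid.
apply: (ideal_finite iI); apply: (sub_finite_set _ (finite_set0 _)) => n /=.
by move=> h; have := leq_maxl (g n) n; rewrite leqNgt (ltn_trans _ h).
Qed.

Lemma bounding_gt_dom (I J K : set (set nat)) : is_ideal I -> is_ideal K ->
  let R := gt_ideal I `&` (D_ideal K `*` D_ideal J) in
  D_ideal K `<=` dom R ->
  bounding (dom R) (ran R) R = bounding (D_ideal K) (D_ideal J) R.
Proof.
move=> iI iK R KR; rewrite ran_gt//; congr bounding.
by apply/seteqP; split=> // f [g [_ []]].
Qed.

Lemma bounding_ge_dom (I J K : set (set nat)) : is_ideal I -> is_ideal K ->
  let R := ge_ideal I `&` (D_ideal K `*` D_ideal J) in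
  D_ideal K `<=` dom R ->
  bounding (dom R) (ran R) R = bounding (D_ideal K) (D_ideal J) R.
Proof.
move=> iI iK R KR; rewrite ran_ge//; congr bounding.
by apply/seteqP; split=> // f [g [_ []]].
Qed.

Lemma card_unit : [set: unit] #= `I_1.
Proof.
by rewrite (_ : [set: unit] = [set tt]) ?card_set1//; apply/seteqP; split=> -[].
Qed.

Lemma bounding_dom_neq1 (X Y : Type) (R : set (X * Y)) :
  ~ bounding (dom R) (ran R) R unit.
Proof.
case=> [[B [[Bdom Bunb] _ B1]]|[_ [[cu _] _]]].
  have /eq_cardSP[x Bx] : B #= `I_1.
    by apply: card_eq_trans card_unit; rewrite card_eq_sym.
  move=> /eqP; rewrite II0 card_eq0 => /eqP/eqP; rewrite setD_eq0 => Bsub.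
  have [y Rxy] := Bdom _ Bx.
  by have [|x' /Bsub -> //] := Bunb y; exists x.
have fu : finite_set [set: unit] by exists 1%N; exact: card_unit.
have : finite_set [set: set nat] := card_le_finite cu fu.
apply/infiniteP; apply/pcard_injP; exists set1 => m n _ _ mn.
by have : [set m] m by []; rewrite mn.
Qed.

Let fin : set (set nat) := [set A | finite_set A].
Let fin_odd : set (set nat) := [set A | finite_set (A `&` [set n | odd n])].

Lemma infinite_parity (b : bool) : infinite_set [set n | odd n = b].
Proof.
move=> fb; apply: infinite_nat.
have -> : [set: nat] = (fun n => (n.*2 + b)%N) @^-1` [set n | odd n = b].
  by apply/seteqP; split=> n //= _; rewrite oddD odd_double; case: b {fb}.
apply: finite_preimage fb => m n _ _ /= /eqP.
by rewrite eqn_add2r => /eqP/double_inj.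
Qed.

Lemma fin_ideal : is_ideal fin.
Proof.
split=> [A B ? ?|A B|A|]; rewrite /fin //=.
- by rewrite finite_setU.
- exact: sub_finite_set.
- exact: infinite_nat.
Qed.

Lemma fin_odd_ideal : is_ideal fin_odd.
Proof.
split=> [A B ? ?|A B AB|A fA|]; rewrite /fin_odd /=.
- by rewrite setIUl finite_setU.
- by apply: sub_finite_set; exact: setSI.
- exact: sub_finite_set (@subIsetl _ _ _) fA.
- by rewrite setTI; exact: (infinite_parity (b := true)).
Qed.

Let evens : nat -> set nat := fun i => [set n | i = 0%N /\ odd n = false].

Lemma evens_P_hat : P_hat fin_odd evens.
Proof.
split=> [n|i j _ _ [m [[-> _] [-> _]]]//].
by apply: (sub_finite_set _ (finite_set0 _)) => m [[_ h]]; rewrite /= h.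
Qed.

Lemma min_card_unit (X : Type) (F : set (set X)) (x : X) :
  F [set x] -> ~ F set0 -> min_card F unit.
Proof.
move=> Fx F0; left; exists [set x]; split=> //.
  move=> C FC; have /set0P[y Cy] : C != set0 by apply: contra_notN F0 => /eqP <-.
  apply: (@card_le_trans _ _ _ [set y]); last by apply: subset_card_le => _ ->.
  have : [set x] #= [set y] by rewrite (card_eql card_set1) card_eq_sym card_set1.
  by rewrite card_eq_le => /andP[].
by rewrite /cardinal_of (card_eqr card_set1) card_unit.
Qed.

Lemma singletons_P_part : P_part fin (fun n => [set n]).
Proof.
split; last by apply/seteqP; split=> // n _; exists n.
by split=> [n|i j _ _ [m [-> ->]]//]; exact: finite_set1.
Qed.

Lemma gt_dom_counterexample : exists I J K : set (set nat),
  let R := gt_ideal I `&` (D_ideal K `*` D_ideal J) in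
  [/\ is_ideal I, is_ideal J, is_ideal K
    & bounding (dom R) (ran R) R <> b_ideal I J K].
Proof.
exists fin, fin, fin_odd; split; [exact: fin_ideal..|exact: fin_odd_ideal|].
move=> eqb; apply: (@bounding_dom_neq1 _ _
  (gt_ideal fin `&` (D_ideal fin_odd `*` D_ideal fin))); rewrite eqb.
apply: (@min_card_unit _ _ evens) => /=; last first.
  by move=> -[_ /(_ _ singletons_P_part)[]].
split=> [_ ->|A [_ Acov]]; first exact: evens_P_hat.
exists evens => //; apply: contra_not (@infinite_parity false).
apply: sub_finite_set => m /= om; have [n _ Anm] : (\bigcup_n A n) m by rewrite Acov.
by exists n => //; split=> //; exists 0%N.
Qed.

Lemma ge_dom_counterexample : exists I J K : set (set nat),
  let R := ge_ideal I `&` (D_ideal K `*` D_ideal J) in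
  [/\ is_ideal I, is_ideal J, is_ideal K
    & bounding (dom R) (ran R) R <> bs_ideal I J K].
Proof.
exists fin, fin, fin_odd; split; [exact: fin_ideal..|exact: fin_odd_ideal|].
move=> eqb; apply: (@bounding_dom_neq1 _ _
  (ge_ideal fin `&` (D_ideal fin_odd `*` D_ideal fin))); rewrite eqb.
apply: (@min_card_unit _ _ evens) => /=; last first.
  by move=> -[_ /(_ _ singletons_P_part)[]].
split=> [_ ->|A [[Afin _] Acov]]; first exact: evens_P_hat.
exists evens => // fU; apply: (infinite_parity (b := false)).
have := Afin 0%N => fA0; have := conj fA0 fU; rewrite -finite_setU.
apply: sub_finite_set => m /= om.
have [[|n] _ Anm] : (\bigcup_n A n) m by rewrite Acov.
  by left.
by right; exists n => //; split=> //; exists 0%N.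
Qed.

End DomainOfTheRelation.

(* Main.v *)
Require Import Defs.
From mathcomp Require Import all_boot.
From mathcomp Require Import boolp classical_sets functions cardinality.

Set Implicit Arguments.
Unset Strict Implicit.
Unset Printing Implicit Defensive.

Local Open Scope classical_set_scope.
Local Open Scope card_scope.

(** A function [f] and the sequence of its fibres carry the same information:
    with [E n = f^-1 {n}] and [A n = g^-1 {n}], the set of [m] such that
    [f m <= g m] is [\bigcup_n (A n `&` \bigcup_(i <= n) E i)], and shifting [A]
    by one turns [<=] into [<]. Passing between functions and sequences of sets
    is therefore a Galois-Tukey connection in both directions, and such
    connections do not increase the bounding number. A sequence that does not
    cover [nat] is completed by sending each uncovered [m] to [m] itself, which
    adds at most one point to each fibre. *)

(** A smallest [B] in [F] has some [C] in [G] below it, and [B] is below all of [G], so [C] is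
    smallest in [G] and equipotent to [B]. If [F] is empty, so is [G], and both minima take the
    default value. *)
Lemma min_card_sub (X Y : Type) (F : set (set X)) (G : set (set Y)) :
  (forall B, F B -> exists2 C, G C & C #<= B) ->
  (forall C, G C -> exists2 B, F B & B #<= C) ->
  min_card F `<=` min_card G.
Proof.
move=> FG GF T [[B [FB Bmin TB]]|[F0 cT]]; last first.
  right; split=> //; apply/seteqP; split=> // C /GF[B].
  by rewrite F0.
have [C GC CB] := FG _ FB.
have Cmin C' : G C' -> B #<= C'.
  by move=> /GF[B' /Bmin BB' B'C']; exact: card_le_trans BB' B'C'.
left; exists C; split=> // [C' /Cmin BC'|]; first exact: card_le_trans CB BC'.
by apply: card_eq_trans TB _; rewrite card_eq_le (Cmin _ GC) CB.
Qed.

(** If some [y] bounded the image of [B], then [psi y] would bound [B]. *)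
Lemma unbounded_image (X Y X' Y' : Type) (D : set X) (C : set Y)
    (R : set (X * Y)) (D' : set X') (C' : set Y') (R' : set (X' * Y'))
    (phi : X -> X') (psi : Y' -> Y) (B : set X) :
  (forall x, D x -> D' (phi x)) -> (forall y, C' y -> C (psi y)) ->
  (forall x y, D x -> C' y -> R' (phi x, y) -> R (x, psi y)) ->
  unbounded D C R B -> unbounded D' C' R' (phi @` B).
Proof.
move=> Dphi Cpsi R'R [BD Bunb]; split=> [_ [x /BD Dx <-]|y C'y].
  exact: Dphi.
have [x Bx nR] := Bunb _ (Cpsi _ C'y).
exists (phi x); first by exists x.
by apply: contra_not nR; apply: R'R => //; exact: BD.
Qed.

Lemma bounding_eq (X Y X' Y' : Type) (D : set X) (C : set Y)
    (R : set (X * Y)) (D' : set X') (C' : set Y') (R' : set (X' * Y'))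
    (phi : X -> X') (psi : Y' -> Y) (phi' : X' -> X) (psi' : Y -> Y') :
  (forall x, D x -> D' (phi x)) -> (forall y, C' y -> C (psi y)) ->
  (forall x y, D x -> C' y -> R' (phi x, y) -> R (x, psi y)) ->
  (forall x, D' x -> D (phi' x)) -> (forall y, C y -> C' (psi' y)) ->
  (forall x y, D' x -> C y -> R (phi' x, y) -> R' (x, psi' y)) ->
  bounding D C R = bounding D' C' R'.
Proof.
move=> h1 h2 h3 h4 h5 h6.
have FG B : unbounded D C R B -> exists2 B', unbounded D' C' R' B' & B' #<= B.
  move=> uB; exists (phi @` B); last exact: card_image_le.
  exact: (unbounded_image h1 h2 h3 uB).
have GF B : unbounded D' C' R' B -> exists2 B', unbounded D C R B' & B' #<= B.
  move=> uB; exists (phi' @` B); last exact: card_image_le.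
  exact: (unbounded_image h4 h5 h6 uB).
by apply/seteqP; split; exact: min_card_sub.
Qed.

Definition fibres (f : nat -> nat) : nat -> set nat :=
  fun n => f @^-1` [set n].

Definition index_of (E : nat -> set nat) : nat -> nat :=
  fun m => xget m [set i | E i m].

Lemma fibres_P_part (J : set (set nat)) (f : nat -> nat) :
  D_ideal J f -> P_part J (fibres f).
Proof.
move=> Df; split; last by apply/seteqP; split=> // m _; exists (f m).
by split=> // i j _ _ [m [<- <-]].
Qed.

Lemma index_of_eq (K : set (set nat)) (E : nat -> set nat) (i m : nat) :
  P_hat K E -> E i m -> index_of E m = i.
Proof.
move=> [_ dE] Eim; apply: dE => //; exists m; split=> //.
exact: (xgetI m (P := [set j | E j m]) Eim).
Qed.

Lemma index_of_mem (J : set (set nat)) (A : nat -> set nat) (m : nat) :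
  P_part J A -> A (index_of A m) m.
Proof.
move=> [_ covA]; have [i _ Aim] : (\bigcup_n A n) m by rewrite covA.
exact: (xgetI m (P := [set j | A j m]) Aim).
Qed.

Lemma index_of_D_ideal (K : set (set nat)) (E : nat -> set nat) :
  is_ideal K -> P_hat K E -> D_ideal K (index_of E).
Proof.
move=> iK [KE _] n; apply: (@ideal_sub _ _ iK _ (E n `|` [set n])).
  by move=> m; rewrite /index_of /=; case: xgetP => [i -> Eim <-|_ ->]; [left|right].
by apply: (idealU iK) => //; apply: (ideal_finite iK); exact: finite_set1.
Qed.

(* The two parts of the theorem are [s = id] with [r = leq] and [s = S] with
   [r = ltn]. *)
Lemma bounding_ideal_shift (I J K : set (set nat)) (s : nat -> nat)
    (r : rel nat) :
  is_ideal I -> is_ideal J -> is_ideal K ->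
  (forall i k, r i k <-> exists2 n, s n = k & (i <= n)%N) ->
  bounding (D_ideal K) (D_ideal J)
    ([set fg | I [set m | r (fg.1 m) (fg.2 m)]] `&` (D_ideal K `*` D_ideal J)) =
  bounding (P_hat K) (P_part J)
    [set EA | I (\bigcup_n (EA.2 (s n) `&`
                            \bigcup_(i in [set i | (i <= n)%N]) EA.1 i))].
Proof.
move=> iI iJ iK rP.
apply: (@bounding_eq _ _ _ _ _ _ _ _ _ _ fibres index_of index_of fibres).
- by move=> f /fibres_P_part[].
- by move=> A [PA _]; exact: index_of_D_ideal.
- move=> f A Df PA IfA; split; last first.
    by split=> //; apply: index_of_D_ideal => //; case: PA.
  (* Since [A] covers [nat], [m] really lies in the cell [A (s n)], and [f m <= n] puts it in one of
     the first fibres of [f]. *)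
  apply: (ideal_sub iI) IfA => m /= /rP[n sn fn].
  exists n => //; split; last by exists (f m).
  by rewrite /= sn; exact: index_of_mem PA.
- by move=> E; exact: index_of_D_ideal.
- exact: fibres_P_part.
(* Only points of some [E i] occur in the union; there disjointness forces [index_of E m = i], so
   the default value never matters. *)
- move=> E g PE Dg [IEg _]; apply: (ideal_sub iI) IEg => m /= [n _ [gm [i le_in Eim]]].
  by apply/rP; exists n => //; rewrite (index_of_eq PE Eim).
Qed.

Theorem theorem3p10 (I J K : set (set nat))
    (hI : is_ideal I) (hJ : is_ideal J) (hK : is_ideal K) :
  bounding (D_ideal K) (D_ideal J)
    (gt_ideal I `&` (D_ideal K `*` D_ideal J)) = b_ideal I J K /\
  bounding (D_ideal K) (D_ideal J)
    (ge_ideal I `&` (D_ideal K `*` D_ideal J)) = bs_ideal I J K.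
Proof.
split.
  (* [b_ideal I J K] unfolds to the bounding number on the side of sequences. *)
  apply: (@bounding_ideal_shift I J K id leq) => // i k.
  by split=> [ik|[n <-]//]; exists k.
apply: (@bounding_ideal_shift I J K S ltn) => // i k.
(* The witness is the predecessor of [k]; for [k = 0] both sides fail, just as [A 0] is absent from
   the shifted union. *)
by split=> [|[n <-]//]; case: k => // k ik; exists k.
Qed.
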